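(* Let $\mathbb{K}$ be any field, let $3\le n<m$ be integers, let $S=\Gamma_m(n)$, and let $R=\mathbb{K}[S]$. Then the Poincaré series $\mathcal{P}^R_{\mathbb{K}}(z)=\sum_{i\ge0}\beta_i^R(\mathbb{K})z^i$ of the residue field $\mathbb{K}$ of $R$ is $$\mathcal{P}^R_{\mathbb{K}}(z)=\frac{1+z}{1-(m-2)z+z^2}.$$
   Context: $\Gamma_m(n)$ is the numerical semigroup generated by $\{m,m+1,\ldots,2m-1\}\setminus\{m+n\}$. For a numerical semigroup $S$, $\mathbb{K}[S]=\mathbb{K}[t^s\mid s\in S]\subseteq\mathbb{K}[t]$, with homogeneous maximal ideal $\mathfrak m=(t^s\mid s\in S,\ s>0)$ and residue field $\mathbb{K}=\mathbb{K}[S]/\mathfrak m$. $\beta_i^R(\mathbb{K})=\dim_{\mathbb{K}}\operatorname{Tor}_i^R(\mathbb{K},\mathbb{K})$. The equality is one of formal power series in $z$. *)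

(* Defs.v *)
From HB Require Import structures.
From mathcomp Require Import all_boot all_order all_algebra.
From mathcomp Require Import boolp zify.

Set Implicit Arguments.
Unset Strict Implicit.
Unset Printing Implicit Defensive.

Import GRing.Theory.
Local Open Scope ring_scope.

(** ** Submonoids of the natural numbers and their semigroup rings *)

(* Finiteness of the complement plays no role in the construction of K[S], so
   it is not a field; see [Gamma_cofinite] for the semigroups of interest. *)
Record submonoid := Submonoid {
  submon_mem :> pred nat;
  submon0 : submon_mem 0%N;
  submonD : forall a b, submon_mem a -> submon_mem b -> submon_mem (a + b)%N }.

Definition generated_mem (A : pred nat) : pred nat :=
  fun k => `[< exists2 s : seq nat, all A s & sumn s = k >].

Lemma generated_mem0 A : generated_mem A 0%N.
Proof. by apply/asboolP; exists [::]. Qed.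

Lemma generated_memD A a b :
  generated_mem A a -> generated_mem A b -> generated_mem A (a + b)%N.
Proof.
move=> /asboolP[s As <-] /asboolP[u Au <-]; apply/asboolP; exists (s ++ u).
  by rewrite all_cat As.
by rewrite sumn_cat.
Qed.

Definition generated (A : pred nat) : submonoid :=
  Submonoid (generated_mem0 A) (@generated_memD A).

Definition Gamma (m n : nat) : submonoid :=
  generated [pred k | (m <= k < 2 * m)%N && (k != m + n)%N].

Lemma Gamma_cofinite m n : (3 <= n)%N -> (n < m)%N ->
  forall k, (2 * m <= k)%N -> Gamma m n k.
Proof.
move=> n3 nm; elim/ltn_ind=> k IH mk.
have gen1 j : (m <= j < 2 * m)%N && (j != m + n)%N -> Gamma m n j.
  by move=> Aj; apply/asboolP; exists [:: j]; rewrite /= ?Aj ?addn0.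
have [k3|k3] := ltnP k (3 * m); last first.
  rewrite -(@subnK m k); last by lia.
  by apply: submonD; [apply: IH; lia | apply: gen1; lia].
have [->|kn] := eqVneq k (2 * m + n)%N.
  have -> : (2 * m + n = (m + 1) + (m + (n - 1)))%N by lia.
  by apply: submonD; apply: gen1; lia.
rewrite -(@subnK m k); last by lia.
by apply: submonD; apply: gen1; lia.
Qed.

Section SemigroupRing.
Variables (K : fieldType) (S : submonoid).

(* The polynomials in t = 'X that are K-combinations of the t^s, s in S. *)
Definition sgpoly : {pred {poly K}} :=
  fun f => [forall i : 'I_(size f), (f`_i != 0) ==> S i].

Lemma sgpolyP (f : {poly K}) : reflect (forall i, f`_i != 0 -> S i) (f \in sgpoly).
Proof.
apply: (iffP forallP) => [Sf i fi|Sf i]; last by apply/implyP/Sf.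
have lt_i : (i < size f)%N.
  by rewrite ltnNge; apply: contraNN fi => le_i; rewrite nth_default.
exact: (implyP (Sf (Ordinal lt_i))).
Qed.

Lemma sgpoly_closed : subring_closed sgpoly.
Proof.
split=> [|f g /sgpolyP Sf /sgpolyP Sg|f g /sgpolyP Sf /sgpolyP Sg].
- apply/sgpolyP=> i; rewrite coef1; case: i => [|i] /=; last by rewrite eqxx.
  by rewrite submon0.
- apply/sgpolyP=> i; rewrite coefB; have [fi0|/Sf//] := eqVneq f`_i 0.
  by rewrite fi0 sub0r oppr_eq0 => /Sg.
- apply/sgpolyP=> i; rewrite coefM; apply: contraNT => nSi.
  apply/eqP/big1 => j _; apply/eqP; apply: contraNT nSi.
  rewrite mulf_eq0 negb_or => /andP[/Sf Sj /Sg Sij].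
  by rewrite -(subnKC (leq_ord j)) submonD.
Qed.

HB.instance Definition _ := GRing.isSubringClosed.Build {poly K} sgpoly
  sgpoly_closed.

Record sgring := SgRing { sgval :> {poly K}; _ : sgval \in sgpoly }.

HB.instance Definition _ := [isSub for sgval].
HB.instance Definition _ := [Choice of sgring by <:].
HB.instance Definition _ := [SubChoice_isSubComNzRing of sgring by <:].

(* The quotient map K[S] -> K[S]/m = K by the homogeneous maximal ideal
   m = (t^s | s in S, s > 0); [sgaug_ker] identifies its kernel. *)
Definition sgaug (f : sgring) : K := (sgval f)`_0.

Fact sgaug_is_additive : zmod_morphism sgaug.
Proof. by move=> f g; rewrite /sgaug /= coefB. Qed.

Fact sgaug_is_multiplicative : monoid_morphism sgaug.
Proof. by split=> [|f g]; rewrite /sgaug /= ?coef1 // coef0M. Qed.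

HB.instance Definition _ := GRing.isZmodMorphism.Build sgring K sgaug
  sgaug_is_additive.
HB.instance Definition _ := GRing.isMonoidMorphism.Build sgring K sgaug
  sgaug_is_multiplicative.

Lemma sgaug_ker (f : sgring) : sgaug f = 0 <->
  exists2 l : seq (sgring * nat),
    all (fun p => S p.2 && (0 < p.2)%N) l &
    sgval f = \sum_(p <- l) sgval p.1 * 'X^(p.2).
Proof.
split=> [f0|[l Sl]]; last first.
  rewrite /sgaug => ->; rewrite coef_sum big_seq big1 // => p /(allP Sl)/andP[_].
  by rewrite coefMXn => ->.
have SC (c : K) : c%:P \in sgpoly.
  apply/sgpolyP=> i; rewrite coefC; case: (i =P 0%N) => [->|_].
    by rewrite submon0.
  by rewrite eqxx.
pose s := [seq i <- iota 0 (size (sgval f)) | (sgval f)`_i != 0].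
exists [seq (SgRing (SC (sgval f)`_i), i) | i <- s].
  apply/allP=> q /mapP[i]; rewrite mem_filter => /andP[fi _] -> /=.
  apply/andP; split; first by have /sgpolyP := valP f; apply.
  by case: i fi => //; rewrite -/(sgaug f) f0 eqxx.
rewrite big_map big_filter /= -[LHS]coefK poly_def.
rewrite -(big_mkord xpredT (fun i => (sgval f)`_i *: 'X^i)) /index_iota subn0.
rewrite (bigID (fun i => (sgval f)`_i != 0)) /= [X in _ + X]big1 ?addr0.
  by apply: eq_bigr => i _; rewrite mul_polyC.
by move=> i; rewrite negbK => /eqP->; rewrite scale0r.
Qed.

End SemigroupRing.

(** ** Free resolutions and Tor *)

(* The field K as an R-module, through eps : R -> K. *)
Definition scalar_module (R : comNzRingType) (K : fieldType)
  (eps : {rmorphism R -> K}) : Type := K.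

Section ScalarModule.
Variables (R : comNzRingType) (K : fieldType) (eps : {rmorphism R -> K}).

HB.instance Definition _ := GRing.Zmodule.on (scalar_module eps).

Definition scalar_module_scale (a : R) (x : scalar_module eps) :
  scalar_module eps := eps a * x.

Fact scalar_module_scaleA a b x :
  scalar_module_scale a (scalar_module_scale b x) =
  scalar_module_scale (a * b) x.
Proof. by rewrite /scalar_module_scale mulrA rmorphM. Qed.

Fact scalar_module_scale1 : left_id 1 scalar_module_scale.
Proof. by move=> x; rewrite /scalar_module_scale rmorph1 mul1r. Qed.

Fact scalar_module_scaleDr : right_distributive scalar_module_scale +%R.
Proof. by move=> a x y; rewrite /scalar_module_scale mulrDr. Qed.

Fact scalar_module_scaleDl x :
  {morph scalar_module_scale^~ x : a b / a + b >-> a + b}.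
Proof. by move=> a b; rewrite /scalar_module_scale rmorphD mulrDl. Qed.

HB.instance Definition _ := GRing.Zmodule_isLmodule.Build R (scalar_module eps)
  scalar_module_scaleA scalar_module_scale1 scalar_module_scaleDr
  scalar_module_scaleDl.

End ScalarModule.

(* A resolution ... -> R^(r 2) -> R^(r 1) -> R^(r 0) -> M -> 0 by free modules
   of finite rank; elements of R^(r i) are row vectors, and the i-th
   differential R^(r i.+1) -> R^(r i) is right multiplication by [res_d i]. *)
Record free_resolution (R : comNzRingType) (M : lmodType R) := FreeResolution {
  res_rank : nat -> nat;
  res_d : forall i, 'M[R]_(res_rank i.+1, res_rank i);
  res_aug : {linear 'rV[R]_(res_rank 0) -> M};
  res_aug_surj : forall x : M, exists v, res_aug v = x;
  res_exact0 : forall v : 'rV[R]_(res_rank 0),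
    res_aug v = 0 <-> exists w, w *m res_d 0 = v;
  res_exactS : forall i (v : 'rV[R]_(res_rank i.+1)),
    v *m res_d i = 0 <-> exists w, w *m res_d i.+1 = v }.

Section Tor.
Variables (R : comNzRingType) (K : fieldType) (eps : {rmorphism R -> K}).
Variables (M : lmodType R) (F : free_resolution M).

(* The complex F (x)_R K: base change along eps turns R^r into K^r and applies
   eps to the entries of the differentials. *)
Definition tensor_d i : 'M[K]_(res_rank F i.+1, res_rank F i) :=
  map_mx eps (res_d F i).

(* dim_K H_i(F (x)_R K) = dim (i-cycles) - dim (i-boundaries). The truncated
   subtraction is harmless, as boundaries are cycles. *)
Definition tor_dim (i : nat) : nat :=
  match i with
  | 0 => (res_rank F 0 - \rank (tensor_d 0))%N
  | j.+1 => (\rank (kermx (tensor_d j)) - \rank (tensor_d j.+1))%N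
  end.

End Tor.

(* beta i = dim_K Tor_i^R(K, K) for all i, K being an R-module through eps.
   Tor is computed by a free resolution of K; it is required both that there is
   one and that the answer is beta i for each of them. *)
Definition betti_numbers (R : comNzRingType) (K : fieldType)
    (eps : {rmorphism R -> K}) (beta : nat -> nat) : Prop :=
  inhabited (free_resolution (scalar_module eps)) /\
  forall (F : free_resolution (scalar_module eps)) i, tor_dim eps F i = beta i.

(** ** Formal power series, as sequences of coefficients *)

Definition fps (A : Type) : Type := nat -> A.

Definition fps_of_poly (A : nzRingType) (p : {poly A}) : fps A := fun i => p`_i.

Section FormalPowerSeries.
Variable A : comUnitRingType.
Implicit Types a b c : fps A.

Definition fps_mul a b : fps A := fun n => \sum_(k < n.+1) a k * b (n - k)%N.

(* The first n coefficients of a / b, by long division. *)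
Fixpoint fps_div_seq a b (n : nat) : seq A :=
  if n is n'.+1 then
    let s := fps_div_seq a b n' in
    rcons s ((a n' - \sum_(k < n') s`_k * b (n' - k)%N) / b 0%N)
  else [::].

Definition fps_div a b : fps A := fun n => (fps_div_seq a b n.+1)`_n.

Lemma size_fps_div_seq a b n : size (fps_div_seq a b n) = n.
Proof. by elim: n => //= n IHn; rewrite size_rcons IHn. Qed.

Lemma nth_fps_div_seq a b n k : (k < n)%N ->
  (fps_div_seq a b n)`_k = fps_div a b k.
Proof.
elim: n => // n IHn; rewrite ltnS leq_eqVlt => /predU1P[->//|lt_kn].
by rewrite /= nth_rcons size_fps_div_seq lt_kn IHn.
Qed.

Lemma fps_divK a b : b 0%N \is a GRing.unit -> fps_mul (fps_div a b) b =1 a.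
Proof.
move=> ub n; rewrite /fps_mul big_ord_recr /= subnn {2}/fps_div /=.
rewrite nth_rcons size_fps_div_seq ltnn eqxx divrK //.
under [X in _ - X]eq_bigr => k _ do rewrite nth_fps_div_seq //.
by rewrite addrC subrK.
Qed.

Lemma fps_div_uniq a b c : b 0%N \is a GRing.unit ->
  fps_mul c b =1 a -> c =1 fps_div a b.
Proof.
move=> ub cb; elim/ltn_ind => n IHn.
move: (fps_divK a ub n); rewrite -cb /fps_mul !big_ord_recr /= subnn.
rewrite (eq_bigr (fun k : 'I_n => c k * b (n - k)%N)); last first.
  by move=> k _; rewrite -IHn.
by move/addrI/(mulIr ub).
Qed.

End FormalPowerSeries.

(* Main.v *)
From HB Require Import structures.
Require Import Defs.
From mathcomp Require Import all_boot all_order all_algebra.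
From mathcomp Require Import boolp zify ring.

Set Implicit Arguments.
Unset Strict Implicit.
Unset Printing Implicit Defensive.

Import Order.TTheory GRing.Theory.
Local Open Scope ring_scope.

(* Let M be the maximal ideal of K[S] and I the ideal spanned by the t^s with
   s <> 0, m + n - 1. Listing the generators t^(m+i) of either ideal in
   increasing order, the successive colon ideals are 0 for t^m, then I for
   t^(m+1), because t^(m+1) t^(m+n-1) = t^(2m+n) is not a multiple of t^m, and M
   for all the others, because t^(m+1) t^(m+n-1) is available by then. So
   {0, I, M} is closed under these colon ideals, much like a Koszul filtration.
   Now filter a submodule N of R^r by the ordered coordinates. If the last
   nonzero entries of the elements of N form, at each coordinate, an ideal of
   the family, then so do those of the first syzygies of N, ordered
   lexicographically. This gives a free resolution of K in which each M
   contributes to the next step one 0, one I and m - 3 times M, and each I one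
   0, one I and m - 4 times M. It is minimal because every t^s with s >= 2m lies
   in M t^m + M t^(m+1). *)

Lemma dependent_choice_nat (T : nat -> Type) (Q : forall i, T i -> Prop)
    (P : forall i, T i -> T i.+1 -> Prop) (x0 : T 0%N) :
  Q 0%N x0 ->
  (forall i x, Q i x -> exists2 y, P i x y & Q i.+1 y) ->
  exists f : forall i, T i, [/\ f 0%N = x0, forall i, Q i (f i) &
    forall i, P i (f i) (f i.+1)].
Proof.
move=> Q0 QS.
pose next i (s : {x : T i | Q i x}) : {y : T i.+1 | Q i.+1 y} :=
  let: exist2 y _ Qy := cid2 (QS i (sval s) (svalP s)) in exist _ y Qy.
pose F := nat_rect (fun i => {x : T i | Q i x}) (exist _ x0 Q0) next.
exists (fun i => sval (F i)); split=> // i; first exact: svalP.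
by rewrite /= /next; case: cid2.
Qed.

Lemma matrix_of_rows (R : Type) p q (P : 'I_p -> 'rV[R]_q -> Prop) :
  (forall i, exists v, P i v) ->
  exists A : 'M[R]_(p, q), forall i, P i (row i A).
Proof.
move=> /choice[f Pf]; exists (\matrix_(i, j) f i 0 j) => i.
suff -> : row i (\matrix_(i, j) f i 0 j) = f i by [].
by apply/rowP => j; rewrite !mxE.
Qed.

Section ComparisonTheorem.
Variables (R : comNzRingType) (M : lmodType R).
Implicit Types F G : free_resolution M.

Definition res_cycle F i : 'rV[R]_(res_rank F i) -> Prop :=
  match i with
  | 0 => fun v => res_aug F v = 0
  | j.+1 => fun v => v *m res_d F j = 0
  end.

Lemma res_exact F i (v : 'rV[R]_(res_rank F i)) :
  res_cycle v <-> exists w, w *m res_d F i = v.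
Proof. by case: i v => [|i] v; [apply: res_exact0 | apply: res_exactS]. Qed.

Lemma res_cycle_row_d F i k : res_cycle (row k (res_d F i)).
Proof. by apply/res_exact; exists (delta_mx 0 k); rewrite rowE. Qed.

Lemma res_d_factor F i p (A : 'M[R]_(p, res_rank F i)) :
  (forall k, res_cycle (row k A)) -> exists B, B *m res_d F i = A.
Proof.
move=> cycA; have [B BA] := matrix_of_rows (fun k => (res_exact _).1 (cycA k)).
by exists B; apply/row_matrixP => k; rewrite row_mul.
Qed.

Lemma res_d_comp F i : res_d F i.+1 *m res_d F i = 0.
Proof.
by apply/row_matrixP => k; rewrite row_mul row0; apply: (res_cycle_row_d k).
Qed.

Definition chain_map F G (f : forall i, 'M[R]_(res_rank F i, res_rank G i)) :=
  forall i, f i.+1 *m res_d G i = res_d F i *m f i.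

Lemma chain_map_exists F G : exists2 f, @chain_map F G f &
  forall v, res_aug G (v *m f 0%N) = res_aug F v.
Proof.
have [f0 f0P] := matrix_of_rows
  (fun k => res_aug_surj G (res_aug F (delta_mx 0 k))).
have augf0 v : res_aug G (v *m f0) = res_aug F v.
  rewrite {2}(row_sum_delta v) mulmx_sum_row !linear_sum /=.
  by apply: eq_bigr => k _; rewrite !linearZ f0P.
pose preserves_cycles i (f : 'M[R]_(res_rank F i, res_rank G i)) :=
  forall v, res_cycle v -> res_cycle (v *m f).
have f0_cycles : preserves_cycles 0%N f0 by move=> v /= v0; rewrite augf0.
have lift i f : preserves_cycles i f ->
    exists2 f', f' *m res_d G i = res_d F i *m f & preserves_cycles i.+1 f'.
  move=> f_cycles; have [|f' f'P] := @res_d_factor G i _ (res_d F i *m f).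
    by move=> k; rewrite row_mul; apply/f_cycles/res_cycle_row_d.
  by exists f' => // v /= v0; rewrite -mulmxA f'P mulmxA v0 mul0mx.
have [f [ff0 _ fP]] := dependent_choice_nat f0_cycles lift.
by exists f => // v; rewrite ff0.
Qed.

Lemma chain_map_null_homotopy F G f : @chain_map F G f ->
  (forall v, res_aug G (v *m f 0%N) = 0) ->
  exists2 h : forall i, 'M[R]_(res_rank F i, res_rank G i.+1),
    f 0%N = h 0%N *m res_d G 0 &
    forall i, f i.+1 = res_d F i *m h i + h i.+1 *m res_d G i.+1.
Proof.
move=> fP f0.
have [k|h0 h0P] := @res_d_factor G 0 _ (f 0%N); first by rewrite rowE /= f0.
pose homotopy_at i (h : 'M[R]_(res_rank F i, res_rank G i.+1)) :=
  res_d F i *m (f i - h *m res_d G i) = 0.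
have h0_homotopy : homotopy_at 0%N h0 by rewrite /homotopy_at h0P subrr mulmx0.
have lift i h : homotopy_at i h ->
    exists2 h', f i.+1 = res_d F i *m h + h' *m res_d G i.+1 &
      homotopy_at i.+1 h'.
  rewrite /homotopy_at => hP; have [k|h' h'P] :=
      @res_d_factor G i.+1 _ (f i.+1 - res_d F i *m h).
    by rewrite /= -row_mul mulmxBl fP -mulmxA -mulmxBr hP row0.
  exists h'; first by rewrite h'P addrC subrK.
  by rewrite h'P opprB addrC subrK mulmxA res_d_comp mul0mx.
have [h [hh0 _ hP]] := dependent_choice_nat h0_homotopy lift.
by exists h => //; rewrite hh0.
Qed.

End ComparisonTheorem.

(* f and g are chain maps between K^p -A-> K^q -A'-> K^q' and
   K^r -B-> K^s -B'-> K^s', and their composite on K^q is homotopic to 1. *)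
Lemma homology_dim_le (K : fieldType) p q q' r s s'
    (A : 'M[K]_(p, q)) (A' : 'M[K]_(q, q')) (B : 'M[K]_(r, s))
    (B' : 'M[K]_(s, s')) (f : 'M[K]_(q, s)) (g : 'M[K]_(s, q))
    (f' : 'M[K]_(q', s')) (g' : 'M[K]_(r, p))
    (h : 'M[K]_(q, p)) (h' : 'M[K]_(q', q)) :
  f *m B' = A' *m f' -> g' *m A = B *m g -> B *m B' = 0 ->
  f *m g - 1%:M = A' *m h' + h *m A ->
  (\rank (kermx A') - \rank A <= \rank (kermx B') - \rank B)%N.
Proof.
move=> fP gP BB hP.
pose C := (kermx B' :\: B)%MS.
have rankC : \rank C = (\rank (kermx B') - \rank B)%N.
  have /capmx_idPr capB : (B <= kermx B')%MS by apply/sub_kermxP.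
  by rewrite -(mxrank_cap_compl (kermx B') B) capB addKn.
have kerB'_sub : (kermx B' <= C + B)%MS.
  by rewrite -(addsmx_diff_cap_eq (kermx B') B) addsmxS ?capmxSr.
have kerA'_sub : (kermx A' <= C *m g + A)%MS.
  have := mulmx_ker A'; move: (kermx A') => k kA'.
  have -> : k = k *m f *m g - k *m h *m A.
    rewrite -[_ *m f *m g]mulmxA -(subrK 1%:M (f *m g)) hP !mulmxDr mulmx1.
    by rewrite !mulmxA kA' mul0mx add0r addrC addKr.
  rewrite addmx_sub //; last first.
    by rewrite -mulNmx (submx_trans (submxMl _ _)) ?addsmxSr.
  have kf_sub : (k *m f <= C + B)%MS.
    apply: submx_trans kerB'_sub; apply/sub_kermxP.
    by rewrite -mulmxA fP mulmxA kA' mul0mx.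
  apply: submx_trans (submxMr g kf_sub) _; rewrite addsmxMr addsmxS //.
  by rewrite -gP submxMl.
rewrite leq_subLR -rankC addnC.
apply: leq_trans (mxrankS kerA'_sub) _.
apply: leq_trans (mxrank_adds_leqif _ _) _.
by rewrite leq_add2r mxrankM_maxl.
Qed.

Section TorInvariance.
Variables (R : comNzRingType) (K : fieldType) (eps : {rmorphism R -> K}).
Variables (M : lmodType R).
Implicit Types F G : free_resolution M.

Lemma tor_dim_le F G i : (tor_dim eps F i <= tor_dim eps G i)%N.
Proof.
have [f fP aug_f] := chain_map_exists F G.
have [g gP aug_g] := chain_map_exists G F.
pose e j := f j *m g j - 1%:M.
have eP : chain_map e.
  move=> j; rewrite /e mulmxBl mul1mx mulmxBr mulmx1 -mulmxA gP mulmxA fP.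
  by rewrite -mulmxA.
have [|h h0 hP] := chain_map_null_homotopy eP.
  by move=> v; rewrite mulmxBr mulmx1 mulmxA linearB /= aug_g aug_f subrr.
case: i => [|i] /=; rewrite /tensor_d.
  have ker0 q : q = \rank (kermx (0 : 'M[K]_(q, 0))).
    by rewrite mxrank_ker mxrank0 subn0.
  rewrite [X in (X - _ <= _)%N]ker0 [X in (_ <= X - _)%N]ker0.
  apply: (homology_dim_le (f := map_mx eps (f 0%N)) (g := map_mx eps (g 0%N))
    (f' := 0) (g' := map_mx eps (g 1%N)) (h := map_mx eps (h 0%N)) (h' := 0)).
  - by rewrite mulmx0 mul0mx.
  - by rewrite -!map_mxM gP.
  - by rewrite mulmx0.
  - by rewrite mul0mx add0r -!map_mxM -h0 /e map_mxB map_mx1.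
apply: (homology_dim_le (f := map_mx eps (f i.+1)) (g := map_mx eps (g i.+1))
  (f' := map_mx eps (f i)) (g' := map_mx eps (g i.+2))
  (h := map_mx eps (h i.+1)) (h' := map_mx eps (h i))).
- by rewrite -!map_mxM fP.
- by rewrite -!map_mxM gP.
- by rewrite -map_mxM res_d_comp map_mx0.
- by rewrite -!map_mxM -map_mxD -hP /e map_mxB map_mx1.
Qed.

Lemma tor_dim_unique F G : tor_dim eps F =1 tor_dim eps G.
Proof. by move=> i; apply/eqP; rewrite eqn_leq !tor_dim_le. Qed.

Lemma tor_dim_minimal F : (forall i, map_mx eps (res_d F i) = 0) ->
  tor_dim eps F =1 res_rank F.
Proof.
by move=> F0 [|i] /=; rewrite /tensor_d !F0 ?mxrank_ker ?mxrank0 !subn0.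
Qed.

End TorInvariance.

Lemma betti_numbers_minimal (R : comNzRingType) (K : fieldType)
    (eps : {rmorphism R -> K}) (F : free_resolution (scalar_module eps)) :
  (forall i, map_mx eps (res_d F i) = 0) -> betti_numbers eps (res_rank F).
Proof.
move=> F0; split=> [|G i]; first exact: (inhabits F).
by rewrite (tor_dim_unique eps G F) tor_dim_minimal.
Qed.

Section LinearKernel.
Variables (R : pzRingType) (U V : lmodType R) (f : {linear U -> V}).

Definition lkernel : {pred U} := fun u => f u == 0.

Fact lkernel_submod_closed : submod_closed lkernel.
Proof.
split=> [|a u v]; rewrite !unfold_in ?linear0 // linearP => /eqP-> /eqP->.
by rewrite scaler0 addr0.
Qed.

HB.instance Definition _ :=
  GRing.isSubmodClosed.Build R U lkernel lkernel_submod_closed.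

End LinearKernel.

Section AugmentedRow.
Variables (R : comNzRingType) (K : fieldType) (eps : {rmorphism R -> K}).

Definition aug_row (v : 'rV[R]_1) : scalar_module eps := eps (v 0 0).

Fact aug_row_is_linear : linear aug_row.
Proof. by move=> a u v; rewrite /aug_row !mxE rmorphD rmorphM. Qed.

HB.instance Definition _ := GRing.isLinear.Build R 'rV[R]_1
  (scalar_module eps) _ aug_row aug_row_is_linear.

End AugmentedRow.

Lemma big_order_enum_val (d : Order.disp_t) (T : finOrderType d) (A : {pred T})
    (V : Type) (idx : V) (op : Monoid.com_law idx) (F : T -> V) :
  \big[op/idx]_(x in A) F x = \big[op/idx]_(i < #|A|) F (Order.enum_val i).
Proof.
have [x Ax|A0] := pickP A.
  rewrite (reindex _ (Order.enum_val_bij_in Ax)).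
  by apply: eq_bigl => i; apply: Order.enum_valP.
rewrite !big_pred0 // => i.
by have := Order.enum_valP i; rewrite unfold_in A0.
Qed.

Lemma lt_order_enum_val (d : Order.disp_t) (T : finOrderType d) (A : {pred T}) :
  {mono @Order.enum_val d T A : i j / (i < j)%O}.
Proof. exact/leW_mono/Order.le_enum_val/le_total. Qed.

Lemma sum_lt_gt (d : Order.disp_t) (T : finOrderType d) (V : nmodType)
    (A : pred T) (x : T) (F : T -> V) :
  A x -> \sum_(y | A y) F y =
    F x + \sum_(y | A y && (y < x)%O) F y + \sum_(y | A y && (x < y)%O) F y.
Proof.
move=> Ax; rewrite (bigD1 x) //= -addrA (bigID (fun y => (y < x)%O)) /=.
congr (_ + (_ + _)); apply: eq_bigl => y.
  by case: ltgtP; rewrite ?andbF ?andbT.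
by case: ltgtP; rewrite ?andbF ?andbT.
Qed.

Section KoszulFiltration.
Variables (R : comNzRingType) (d : Order.disp_t) (I : finOrderType d).
Variables (L : Type) (gen : I -> R) (gens : L -> pred I) (colon : L -> I -> L).
Variables P Q : zmodClosed R.
Implicit Types (l : L) (i : I) (a : R) (c : I -> R).

Definition gen_span (C : {pred R}) (A : pred I) a : Prop :=
  exists2 c, forall i, c i \in C & a = \sum_(i | A i) c i * gen i.

Lemma gen_spanD (C : {pred R}) (A : pred I) a b :
  {in C &, forall x y, x + y \in C} ->
  gen_span C A a -> gen_span C A b -> gen_span C A (a + b).
Proof.
move=> CD [c cC ->] [c' c'C ->]; exists (fun i => c i + c' i) => [i|].
  exact: CD.
by rewrite -big_split; apply: eq_bigr => i _; rewrite mulrDl.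
Qed.

Lemma mem_gen_span (C : addrClosed R) (A : pred I) i a :
  A i -> a \in C -> gen_span C A (a * gen i).
Proof.
move=> Ai aC; exists (fun j => if j == i then a else 0) => [j|].
  by case: eqP => // _; apply: rpred0.
rewrite (bigD1 i) //= eqxx big1 ?addr0 // => j /andP[_ /negbTE->].
by rewrite mul0r.
Qed.

Definition label_ideal l : R -> Prop := gen_span predT (gens l).

Definition preceding l i : pred I := fun j => gens l j && (j < i)%O.

(* A local analogue of the Koszul filtrations of Conca, Trung and Valla. The
   sets P and Q stand for the maximal ideal and its square; over a graded
   algebra, degrees would provide the coefficients in P that [label_ideal_in]
   and [sub_colon] ask for. *)
Record koszul_filtration : Prop := KoszulFiltration {
  gen_in : forall l i, gens l i -> gen i \in P;
  mul_in : {in P &, forall a b, a * b \in Q};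
  label_ideal_in : forall l a,
    label_ideal l a -> a \in Q -> gen_span P (gens l) a;
  colon_sub : forall l i a, gens l i ->
    gen_span predT (preceding l i) (a * gen i) -> label_ideal (colon l i) a;
  sub_colon : forall l i j, gens l i -> gens (colon l i) j ->
    gen_span P (preceding l i) (gen j * gen i) }.

Fixpoint colon_betti l (n : nat) : nat :=
  if n is n'.+1 then (\sum_(i | gens l i) colon_betti (colon l i) n')%N else 1.

Record shape := Shape {
  shape_rank :> nat; shape_label : 'I_shape_rank -> L }.

Definition next_index (s : shape) : {pred 'I_s *l I} :=
  fun p => gens (shape_label p.1) p.2.
Arguments next_index : clear implicits.

Definition next_label (s : shape) (p : 'I_s *l I) : L :=
  colon (shape_label p.1) p.2.

Definition next_shape (s : shape) : shape :=
  @Shape #|next_index s| (fun y => next_label (Order.enum_val y)).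

Lemma sum_next_index (s : shape) (V : nmodType) (F : 'I_s *l I -> V) :
  \sum_(p in next_index s) F p =
  \sum_(k < s) \sum_(i | gens (shape_label k) i) F (k, i).
Proof. by rewrite pair_big_dep /=; apply: eq_big => [p|[]]. Qed.

Lemma sum_next_index_fst (s : shape) (V : nmodType) (k : 'I_s)
    (F : 'I_s *l I -> V) :
  \sum_(p in next_index s | p.1 == k) F p =
  \sum_(i | gens (shape_label k) i) F (k, i).
Proof.
rewrite big_mkcondr sum_next_index (bigD1 k) //= [X in _ + X]big1 ?addr0.
  by apply: eq_bigr => i _; rewrite eqxx.
by move=> j /negbTE jk; apply: big1 => i _; rewrite jk.
Qed.

Lemma rank_iter_next_shape (n : nat) (s : shape) :
  shape_rank (iter n next_shape s) =
  (\sum_(k < s) colon_betti (shape_label k) n)%N.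
Proof.
elim: n s => [|n IHn] s; first by rewrite sum1_card card_ord.
rewrite iterSr IHn.
rewrite -(big_order_enum_val _ _ (fun p => colon_betti (next_label p) n)).
exact: (@sum_next_index s nat).
Qed.

Definition vanishes_from r (b : nat) (v : 'rV[R]_r) : Prop :=
  forall j : 'I_r, (b <= j)%N -> v 0 j = 0.

Definition lifts_gen r (N : {pred 'rV[R]_r}) (k : 'I_r) i (v : 'rV[R]_r) :=
  [/\ v \in N, vanishes_from k.+1 v, forall j, v 0 j \in P & v 0 k = gen i].

Record filtered_by (s : shape) (N : {pred 'rV[R]_s}) : Prop := FilteredBy {
  filtered_lead : forall v (k : 'I_s), v \in N -> vanishes_from k.+1 v ->
    label_ideal (shape_label k) (v 0 k);
  filtered_lift : forall (k : 'I_s) i, gens (shape_label k) i ->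
    exists v, lifts_gen N k i v }.

Hypothesis KF : koszul_filtration.

Lemma label_ideal_combination l a : label_ideal l a ->
  exists2 c, a \in Q -> forall i, c i \in P &
    a = \sum_(i | gens l i) c i * gen i.
Proof.
move=> la; have [aQ|_] := boolP (a \in Q).
  by have [c cP ->] := label_ideal_in KF la aQ; exists c.
by case: la => c _ ->; exists c.
Qed.

Section FirstSyzygies.
Variables (s : shape) (N : submodClosed 'rV[R]_s).
Hypothesis NF : @filtered_by s N.
Variable g : 'I_s *l I -> 'rV[R]_s.
Hypothesis gP : {in next_index s, forall p, lifts_gen N p.1 p.2 (g p)}.
Implicit Types (p : 'I_s *l I) (k : 'I_s).

Definition next_d : 'M[R]_(next_shape s, s) := \matrix_y g (Order.enum_val y).

Lemma mul_next_d (w : 'I_s *l I -> R) :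
  (\row_y w (Order.enum_val y)) *m next_d =
  \sum_(p in next_index s) w p *: g p.
Proof.
rewrite mulmx_sum_row (big_order_enum_val _ _ (fun p => w p *: g p)).
by apply: eq_bigr => y _; rewrite mxE rowK.
Qed.

Definition slice k c : 'rV[R]_s :=
  \sum_(i | gens (shape_label k) i) c i *: g (k, i).

Lemma slice_in k c : slice k c \in N.
Proof.
by apply: rpred_sum => i li; apply: rpredZ; have [] := @gP (k, i) li.
Qed.

Lemma slice_vanishes k c : vanishes_from k.+1 (slice k c).
Proof.
move=> j kj; rewrite summxE big1 // => i li; rewrite mxE.
by have [_ gk0 _ _] := @gP (k, i) li; rewrite gk0 ?mulr0.
Qed.

Lemma slice_lead k c :
  slice k c 0 k = \sum_(i | gens (shape_label k) i) c i * gen i.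
Proof.
rewrite summxE; apply: eq_bigr => i li; rewrite mxE.
by have [_ _ _ ->] := @gP (k, i) li.
Qed.

Lemma slice_coord_in k c j : (forall i, c i \in P) -> slice k c 0 j \in Q.
Proof.
move=> cP; rewrite summxE; apply: rpred_sum => i li; rewrite mxE.
by have [_ _ gkP _] := @gP (k, i) li; apply: (mul_in KF).
Qed.

Lemma sum_slice k c :
  \sum_(p in next_index s) (if p.1 == k then c p.2 else 0) *: g p = slice k c.
Proof.
transitivity (\sum_(p in next_index s | p.1 == k) c p.2 *: g p).
  by rewrite big_mkcondr; apply: eq_bigr => p _; case: ifP; rewrite ?scale0r.
exact: sum_next_index_fst.
Qed.

Lemma filtered_span (b : nat) v : (b <= s)%N ->
  v \in N -> vanishes_from b v ->
  exists w, [/\ (forall j, v 0 j \in Q) -> forall p, w p \in P,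
    forall p : 'I_s *l I, (b <= p.1)%N -> w p = 0 &
    v = \sum_(p in next_index s) w p *: g p].
Proof.
elim: b v => [|b IHb] v leb Nv v0.
  exists (fun=> 0); split=> // [_ p|]; first exact: rpred0.
  by rewrite big1 => [|p _]; [apply/rowP => j; rewrite v0 ?mxE|rewrite scale0r].
pose k : 'I_s := Ordinal leb.
have [c cP vk] := label_ideal_combination (filtered_lead NF (k := k) Nv v0).
have [|||w [wP w0 vw]] := IHb (v - slice k c); first exact: ltnW.
- by rewrite -scaleN1r rpredD // rpredZ // slice_in.
- move=> j; rewrite leq_eqVlt !mxE => /predU1P[bj|bj].
    have -> : j = k by apply: val_inj.
    by rewrite slice_lead -vk subrr.
  by rewrite v0 // slice_vanishes // subrr.
exists (fun p => (if p.1 == k then c p.2 else 0) + w p); split=> [vQ p|p bp|].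
- rewrite rpredD //; first by case: ifP => _; [apply: cP | apply: rpred0].
  by apply: wP => j; rewrite !mxE rpredB ?slice_coord_in //; apply: cP.
- by rewrite w0 1?ltnW // addr0; case: eqP bp => // ->; rewrite ltnn.
- under eq_bigr do rewrite scalerDl.
  by rewrite big_split /= sum_slice -vw addrC subrK.
Qed.

Lemma next_d_exact v : v \in N <-> exists w, w *m next_d = v.
Proof.
split=> [Nv|[w <-]]; last first.
  rewrite mulmx_sum_row; apply: rpred_sum => y _; rewrite rowK.
  by apply: rpredZ; have [] := gP (Order.enum_valP y).
have v0 : vanishes_from s v by move=> j; rewrite leqNgt ltn_ord.
have [w [_ _ ->]] := filtered_span (leqnn s) Nv v0.
by exists (\row_y w (Order.enum_val y)); rewrite mul_next_d.
Qed.

Lemma combination_coord (w : 'I_s *l I -> R) k :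
  (forall q : 'I_s *l I, (k < q.1)%N -> w q = 0) ->
  (\sum_(q in next_index s) w q *: g q) 0 k =
  \sum_(i | gens (shape_label k) i) w (k, i) * gen i.
Proof.
move=> w0; rewrite summxE (bigID (fun q => q.1 == k)) /= sum_next_index_fst.
rewrite [X in _ + X]big1 ?addr0 => [|q /andP[/gP[_ gq0 _ _] qk]].
  by apply: eq_bigr => i li; rewrite mxE; have [_ _ _ ->] := @gP (k, i) li.
rewrite mxE; have [qk'|kq|/val_inj qk'] := ltngtP (q.1) k.
- by rewrite gq0 // mulr0.
- by rewrite w0 // mul0r.
- by rewrite qk' eqxx in qk.
Qed.

Lemma syzygy_lead w p : p \in next_index s ->
  (forall q, (p < q)%O -> w q = 0) ->
  \sum_(q in next_index s) w q *: g q = 0 -> label_ideal (next_label p) (w p).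
Proof.
case: p => k i li w0 w_syz.
have := @combination_coord w k; rewrite w_syz mxE (sum_lt_gt _ li) /=.
rewrite [X in _ + _ + X]big1 ?addr0 => [lead_eq|j /andP[_ ij]]; last first.
  by rewrite w0 ?mul0r // ltEprodlexi /= lexx ij.
apply: (colon_sub KF li); exists (fun j => - w (k, j)) => //.
under eq_bigr do rewrite mulNr.
rewrite sumrN; apply/eqP; rewrite -addr_eq0 -lead_eq // => q kq.
by rewrite w0 // ltEprodlexi !leEord /= (ltnW kq) leqNgt kq.
Qed.

Lemma syzygy_lift p i : p \in next_index s -> gens (next_label p) i ->
  exists w, [/\ forall q, w q \in P, w p = gen i,
    forall q, (p < q)%O -> w q = 0 &
    \sum_(q in next_index s) w q *: g q = 0].
Proof.
case: p => k i0 /= li0 li; have [c cP eq_c] := sub_colon KF li0 li.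
pose relation j := if j == i0 then gen i else if (j < i0)%O then - c j else 0.
have relation_in j : relation j \in P.
  rewrite /relation; case: eqP => _; first exact: (gen_in KF li).
  by case: ifP; rewrite ?rpred0 ?rpredN.
have relation_gt j : (i0 < j)%O -> relation j = 0.
  by rewrite /relation; case: ltgtP.
have slice0 : slice k relation 0 k = 0.
  rewrite slice_lead (sum_lt_gt _ li0) [X in _ + X]big1 => [|j /andP[_ ij]].
    rewrite /relation eqxx eq_c addr0; apply/eqP; rewrite addr_eq0 -sumrN.
    apply/eqP/eq_bigr => j /andP[_ ji].
    by rewrite lt_eqF // ji mulNr opprK.
  by rewrite relation_gt ?mul0r.
have [|||w [wP w0 eq_w]] := @filtered_span k (slice k relation).
- exact: ltnW.
- exact: slice_in.
- move=> j; rewrite leq_eqVlt => /predU1P[/val_inj <- //|].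
  exact: slice_vanishes.
exists (fun q => (if q.1 == k then relation q.2 else 0) - w q).
split=> /= [q||q|].
- rewrite rpredB //; first by case: ifP; rewrite ?rpred0.
  by apply: wP => j; apply: slice_coord_in.
- by rewrite eqxx w0 //= subr0 /relation eqxx.
- rewrite ltEprodlexi /= => /andP[kq /implyP lt_q]; rewrite w0 // subr0.
  by case: eqP => // qk; rewrite relation_gt // lt_q // qk.
- under eq_bigr do rewrite scalerBl.
  by rewrite sumrB sum_slice -eq_w subrr.
Qed.

Lemma filtered_by_ker_next_d :
  @filtered_by (next_shape s) (lkernel (mulmxr next_d)).
Proof.
split=> [v y|y i li].
- rewrite unfold_in /= => /eqP vD v0; set p := Order.enum_val y.
  have yA := Order.enum_valP y.
  pose w q := if q \in next_index s then v 0 (Order.enum_rank_in yA q) else 0.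
  have wE z : w (Order.enum_val z) = v 0 z.
    by rewrite /w Order.enum_valP Order.enum_valK_in.
  rewrite -wE; apply: syzygy_lead => // [q pq|].
    rewrite /w; case: ifP => // qA; apply: v0.
    by move: pq; rewrite -{1}(Order.enum_rankK_in yA qA) lt_order_enum_val.
  rewrite -mul_next_d -[RHS]vD; congr (_ *m _).
  by apply/rowP => z; rewrite mxE wE.
- have [w [wP wp w0 w_syz]] := syzygy_lift (Order.enum_valP y) li.
  exists (\row_z w (Order.enum_val z)); split=> [|z yz|z|]; rewrite ?mxE //.
    by rewrite unfold_in /= mul_next_d w_syz.
  by apply: w0; rewrite lt_order_enum_val ltEord.
Qed.

End FirstSyzygies.

Lemma first_syzygies (s : shape) (N : submodClosed 'rV[R]_s) :
  @filtered_by s N ->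
  exists D : 'M[R]_(next_shape s, s),
    [/\ forall y k, D y k \in P, forall v, v \in N <-> exists w, w *m D = v &
        @filtered_by (next_shape s) (lkernel (mulmxr D))].
Proof.
move=> NF; have /choice[g gP] : forall p : 'I_s *l I, exists v,
    p \in next_index s -> lifts_gen N p.1 p.2 v.
  move=> p; have [pA|] := boolP (p \in next_index s); last by exists 0.
  by have [v vP] := filtered_lift NF pA; exists v.
exists (next_d g); split=> [y k||].
- by rewrite mxE; have [_ _ + _] := gP _ (Order.enum_valP y); apply.
- exact: (next_d_exact NF gP).
- exact: (filtered_by_ker_next_d NF gP).
Qed.

Section ResidueField.
Variables (K : fieldType) (eps : {rmorphism R -> K}) (l : L).
Hypothesis eps_surj : forall x, exists a, eps a = x.
Hypothesis epsP : {in P, forall a, eps a = 0}.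
Hypothesis ker_eps : forall a, eps a = 0 -> label_ideal l a.

Definition residue_shape : shape := @Shape 1 (fun=> l).

Lemma filtered_by_aug_row : @filtered_by residue_shape (lkernel (aug_row eps)).
Proof.
split=> [v k + _|k i li]; first by rewrite ord1 => /eqP/ker_eps.
exists (const_mx (gen i)); have giP := gen_in KF li.
split=> [|j|j|]; rewrite ?mxE //; last by rewrite (ord1 j).
by rewrite unfold_in /= /aug_row mxE epsP.
Qed.

Theorem koszul_betti_numbers : betti_numbers eps (colon_betti l).
Proof.
pose shapes n := iter n next_shape residue_shape.
pose T n := 'M[R]_(shapes n.+1, shapes n).
pose minimal n (D : T n) := (forall y k, D y k \in P) /\
  @filtered_by (shapes n.+1) (lkernel (mulmxr D)).
pose exact_pair n (D : T n) (D' : T n.+1) :=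
  forall v : 'rV_(shapes n.+1), v *m D = 0 <-> exists w, w *m D' = v.
have [D0 [D0P D0_exact D0F]] := first_syzygies filtered_by_aug_row.
have minimalS n D : minimal n D ->
    exists2 D' : T n.+1, exact_pair n D D' & minimal n.+1 D'.
  move=> [_ /first_syzygies[D' [D'P D'_exact D'F]]]; exists D' => // v.
  by rewrite -D'_exact; split=> /eqP.
have [D [DD0 Dmin Dexact]] :=
  @dependent_choice_nat T minimal exact_pair D0 (conj D0P D0F) minimalS.
have aug_surj x : exists v, aug_row eps v = x.
  by have [a <-] := eps_surj x; exists (const_mx a); rewrite /aug_row mxE.
have aug_exact v : aug_row eps v = 0 <-> exists w, w *m D 0%N = v.
  by rewrite DD0 -D0_exact; split=> /eqP.
have -> : colon_betti l = shape_rank \o shapes.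
  by apply/funext => n; rewrite /= rank_iter_next_shape big_ord1.
apply: (betti_numbers_minimal
  (F := @FreeResolution _ (scalar_module eps) _ D (aug_row eps)
          aug_surj aug_exact Dexact)) => n.
by apply/matrixP => y k; rewrite !mxE; apply: epsP; apply: (Dmin n).1.
Qed.

End ResidueField.

End KoszulFiltration.

#[local] Arguments submon_mem : simpl never.

Section SemigroupRing.
Variables (K : fieldType) (S : submonoid).
Implicit Types (f g : sgring K S) (s d j : nat).

Definition sgmon s : sgring K S := insubd 0 'X^s.

Definition sgconst (a : K) : sgring K S := insubd 0 a%:P.

Lemma val_sgmon s : S s -> sgval (sgmon s) = 'X^s.
Proof.
move=> Ss; apply: insubdK; apply/sgpolyP => i.
by rewrite coefXn; case: (i =P s) => [-> //|_]; rewrite eqxx.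
Qed.

Lemma val_sgconst a : sgval (sgconst a) = a%:P.
Proof.
apply: insubdK; apply/sgpolyP => i.
by rewrite coefC; case: (i =P 0%N) => [-> _|]; rewrite ?eqxx ?submon0.
Qed.

Lemma sgaug_surj (a : K) : exists f, sgaug f = a.
Proof. by exists (sgconst a); rewrite /sgaug val_sgconst coefC. Qed.

Lemma coef_gap f j : ~~ S j -> f`_j = 0.
Proof. by have /sgpolyP Sf := valP f; move=> /(contraNeq (Sf j)). Qed.

Lemma coef_sgsum (T : Type) (r : seq T) (A : pred T) (F : T -> sgring K S) j :
  (\sum_(x <- r | A x) F x)`_j = \sum_(x <- r | A x) (F x)`_j.
Proof.
rewrite -coef_sum; congr (polyseq _)`_j.
exact: (raddf_sum (val : sgring K S -> {poly K})).
Qed.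

Lemma coef_mul_sgmon f s j : S s ->
  (f * sgmon s)`_j = if (j < s)%N then 0 else f`_(j - s).
Proof. by move=> Ss; rewrite /= val_sgmon // coefMXn. Qed.

Lemma coef_sgconst_mul a f j : (sgconst a * f)`_j = a * f`_j.
Proof. by rewrite /= val_sgconst coefCM. Qed.

Lemma sgmonD s d : S s -> S d -> sgmon (s + d) = sgmon s * sgmon d.
Proof.
by move=> Ss Sd; apply: val_inj; rewrite /= !val_sgmon ?submonD // exprD.
Qed.

Lemma sgmon_dvd f s : S s ->
  (forall j, f`_j != 0 -> (s <= j)%N /\ S (j - s)%N) ->
  exists2 g, f = g * sgmon s & forall j, g`_j = f`_(j + s).
Proof.
move=> Ss fs; have Sdrop : drop_poly s (sgval f) \in sgpoly S.
  by apply/sgpolyP => j; rewrite coef_drop_poly => /fs[_]; rewrite addnK.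
exists (SgRing Sdrop) => [|j]; last exact: coef_drop_poly.
apply: val_inj; apply/polyP => j; rewrite coef_mul_sgmon // coef_drop_poly.
case: ltnP => [js|/subnK-> //]; apply/eqP; apply: contraTT js => /fs[sj _].
by rewrite -leqNgt.
Qed.

Definition sgorder_ge d : {pred sgring K S} :=
  fun f => take_poly d (sgval f) == 0.

Lemma sgorder_geP d f :
  reflect (forall j, (j < d)%N -> f`_j = 0) (f \in sgorder_ge d).
Proof.
apply: (iffP eqP) => [f0 j jd|f0].
  by have := coef_take_poly d (sgval f) j; rewrite f0 jd coef0.
by apply/polyP => j; rewrite coef_take_poly coef0; case: ifP => [/f0|].
Qed.

Fact sgorder_ge_zmod_closed d : zmod_closed (sgorder_ge d).
Proof.
split=> [|f g /sgorder_geP f0 /sgorder_geP g0]; apply/sgorder_geP => j jd.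
  exact: coef0.
by rewrite /= coefB f0 // g0 // subrr.
Qed.

HB.instance Definition _ d := GRing.isZmodClosed.Build (sgring K S)
  (sgorder_ge d) (sgorder_ge_zmod_closed d).

Lemma sgorder_geM d d' f g : f \in sgorder_ge d -> g \in sgorder_ge d' ->
  f * g \in sgorder_ge (d + d').
Proof.
move=> /sgorder_geP f0 /sgorder_geP g0; apply/sgorder_geP => j jd.
rewrite /= coefM big1 // => i _; have [id|id] := ltnP i d.
  by rewrite f0 ?mul0r.
by rewrite g0 ?mulr0 //; have := leq_ord i; lia.
Qed.

Lemma sgmon_order_ge s d : (d <= s)%N -> sgmon s \in sgorder_ge d.
Proof.
move=> ds; have [Ss|/negbTE nSs] := boolP (S s); last first.
  suff -> : sgmon s = 0 by apply: rpred0.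
  rewrite /sgmon /insubd insubN //; apply/negP => /sgpolyP/(_ s).
  by rewrite coefXn eqxx oner_eq0 nSs => /(_ isT).
apply/sgorder_geP => j jd; rewrite val_sgmon // coefXn.
by rewrite ltn_eqF // (leq_trans jd).
Qed.

End SemigroupRing.

Lemma GammaE m n k : (3 <= n)%N -> (n < m)%N ->
  Gamma m n k = (k == 0)%N || ((m <= k)%N && (k != m + n)%N).
Proof.
move=> n3 nm; apply/idP/idP.
  move=> /asboolP[[|a [|b s]]] /=; first by move=> _ <-.
    by rewrite addn0 andbT => gen_a <-; lia.
  by move=> /and3P[gen_a gen_b _] <-; lia.
case/orP => [/eqP->|kP]; first exact: submon0.
have [k2|k2] := leqP (2 * m) k; first exact: Gamma_cofinite.
by apply/asboolP; exists [:: k]; rewrite /= ?addn0 // andbT; lia.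
Qed.

Inductive Gamma_label := ZeroIdeal | PuncturedIdeal | MaximalIdeal.

Section GammaKoszul.
Variables (K : fieldType) (m n : nat).
Hypotheses (n3 : (3 <= n)%N) (nm : (n < m)%N).
Local Notation S := (Gamma m n).
Local Notation R := (sgring K (Gamma m n)).
Implicit Types (l : Gamma_label) (i k : 'I_m) (f : R) (j s : nat).

Definition Gamma_gen i : R := sgmon K S (m + i).

Definition Gamma_gens l : pred 'I_m := fun i =>
  match l with
  | ZeroIdeal => false
  | PuncturedIdeal => (i != n :> nat) && (i != n.-1 :> nat)
  | MaximalIdeal => i != n :> nat
  end.

Definition Gamma_colon (_ : Gamma_label) i : Gamma_label :=
  match nat_of_ord i with
  | 0 => ZeroIdeal
  | 1 => PuncturedIdeal
  | _ => MaximalIdeal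
  end.

Local Notation ideal := (label_ideal Gamma_gen Gamma_gens).

Fact ord_m0_subproof : (0 < m)%N. Proof. lia. Qed.
Fact ord_m1_subproof : (1 < m)%N. Proof. lia. Qed.
Definition ord_m0 : 'I_m := Ordinal ord_m0_subproof.
Definition ord_m1 : 'I_m := Ordinal ord_m1_subproof.

Lemma Gamma_gens_mem l i : Gamma_gens l i -> S (m + i)%N.
Proof. by case: l => //=; rewrite GammaE //; lia. Qed.

Lemma Gamma_gens_le1 l i i' :
  Gamma_gens l i -> (i' <= 1)%N -> Gamma_gens l i'.
Proof. by case: l => //= _; lia. Qed.

Lemma coef_mul_Gamma_gen l i f j : Gamma_gens l i ->
  (f * Gamma_gen i)`_(m + j) = if (j < i)%N then 0 else f`_(j - i).
Proof.
by move=> /Gamma_gens_mem Si; rewrite coef_mul_sgmon // ltn_add2l subnDl.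
Qed.

(* Every s >= 2m lies in m + S, except 2m + n = (m + n - 1) + (m + 1). *)
Lemma order_ge_2m_split f : f \in sgorder_ge (m + m) ->
  exists c0 c1, [/\ c0 \in sgorder_ge m, c1 \in sgorder_ge m &
    f = c0 * sgmon K S m + c1 * sgmon K S (m + 1)].
Proof.
move=> /sgorder_geP f0; pose a := f`_(m + m + n).
have Sm : S m by rewrite GammaE //; lia.
have Sm1 : S (m + 1)%N by rewrite GammaE //; lia.
have Smn1 : S (m + n.-1)%N by rewrite GammaE //; lia.
pose c1 := sgconst S a * sgmon K S (m + n.-1).
have c1E : c1 * sgmon K S (m + 1) = sgconst S a * sgmon K S (m + m + n).
  by rewrite -mulrA -sgmonD //; congr (_ * sgmon _ _ _); lia.
have S2mn : S (m + m + n)%N by rewrite GammaE //; lia.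
have rest_coef j : (f - c1 * sgmon K S (m + 1))`_j =
    if j == (m + m + n)%N then 0 else f`_j.
  rewrite c1E coefB coef_sgconst_mul val_sgmon // coefXn.
  by case: eqP => [->|_]; rewrite ?mulr1 ?mulr0 ?subr0 ?subrr.
have [j|c0 c0E c0_coef] := @sgmon_dvd _ _ (f - c1 * sgmon K S (m + 1)) m Sm.
  rewrite rest_coef; have [_|jn fj] := eqVneq j _; first by rewrite eqxx.
  have jm : (m + m <= j)%N.
    by rewrite leqNgt; apply: contraNN fj => /f0->.
  by rewrite GammaE //; lia.
exists c0, c1; split.
- apply/sgorder_geP => j jm; rewrite c0_coef rest_coef.
  by case: ifP => // _; rewrite f0 // ltn_add2r.
- apply/sgorder_geP => j jm; rewrite coef_sgconst_mul.
  have /sgorder_geP -> // := @sgmon_order_ge K S (m + n.-1) m (leq_addr _ _).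
  exact: mulr0.
- by rewrite -c0E subrK.
Qed.

Lemma Gamma_span_order_ge_2m l f : Gamma_gens l ord_m0 ->
  f \in sgorder_ge (m + m) ->
  gen_span Gamma_gen (sgorder_ge m) (Gamma_gens l) f.
Proof.
move=> l0 /order_ge_2m_split[c0 [c1 [c0m c1m ->]]].
have l1 : Gamma_gens l ord_m1 by apply: Gamma_gens_le1 l0 _.
apply: gen_spanD; [exact: rpredD | | exact: (mem_gen_span _ l1)].
by have := mem_gen_span Gamma_gen l0 c0m; rewrite /Gamma_gen addn0.
Qed.

Lemma coef_Gamma_combination l (a : 'I_m -> K) i :
  (\sum_(k | Gamma_gens l k) sgconst S (a k) * Gamma_gen k)`_(m + i) =
  if Gamma_gens l i then a i else 0.
Proof.
have genE k : Gamma_gens l k ->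
    (sgconst S (a k) * Gamma_gen k)`_(m + i) = a k * (i == k)%:R.
  move=> /Gamma_gens_mem Sk.
  by rewrite coef_sgconst_mul val_sgmon // coefXn eqn_add2l.
rewrite coef_sgsum (eq_bigr _ genE) big_mkcond (bigD1 i) //= eqxx mulr1.
rewrite big1 ?addr0 // => k /negbTE; rewrite eq_sym => ->.
by rewrite mulr0 if_same.
Qed.

Lemma mem_Gamma_ideal l f : Gamma_gens l ord_m0 -> f \in sgorder_ge m ->
  (forall i, ~~ Gamma_gens l i -> f`_(m + i) = 0) -> ideal l f.
Proof.
move=> l0 fm fl.
pose low := \sum_(i | Gamma_gens l i) sgconst S f`_(m + i) * Gamma_gen i.
have low_m : low \in sgorder_ge m.
  apply/sgorder_geP => j jm; rewrite coef_sgsum big1 // => i li.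
  by rewrite coef_mul_sgmon ?(Gamma_gens_mem li) // ltn_addr.
have high_2m : f - low \in sgorder_ge (m + m).
  apply/sgorder_geP => j j2m; have [jm|mj] := ltnP j m.
    by have /sgorder_geP -> := rpredB fm low_m.
  have jm : (j - m < m)%N by lia.
  have -> : j = (m + Ordinal jm)%N by rewrite /= subnKC.
  rewrite coefB coef_Gamma_combination.
  by case: ifP => [_|/negbT/fl->]; rewrite subrr.
rewrite -(subrK low f); apply: gen_spanD => //; last first.
  by exists (fun i => sgconst S f`_(m + i)).
by have [c _ ->] := Gamma_span_order_ge_2m l0 high_2m; exists c.
Qed.

Lemma mem_Gamma_maximal_ideal f : f \in sgorder_ge m -> ideal MaximalIdeal f.
Proof.
move=> fm; apply: mem_Gamma_ideal => // [|i]; first by rewrite /=; lia.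
by rewrite /= negbK => /eqP->; apply: coef_gap; rewrite GammaE //; lia.
Qed.

Lemma Gamma_colon_sub l i f : Gamma_gens l i ->
  gen_span Gamma_gen predT (preceding Gamma_gens l i) (f * Gamma_gen i) ->
  ideal (Gamma_colon l i) f.
Proof.
move=> li [c _ eq_f].
have f_coef j :
    f`_j = \sum_(k | Gamma_gens l k && (k < i)%N) (c k)`_(j + (i - k)).
  have <- : (f * Gamma_gen i)`_(m + (j + i)) = f`_j.
    by rewrite (coef_mul_Gamma_gen _ _ li) ltnNge leq_addl addnK.
  rewrite eq_f coef_sgsum; apply: eq_bigr => k /andP[lk ki].
  rewrite (coef_mul_Gamma_gen _ _ lk) ltnNge (leq_trans (ltnW ki)) ?leq_addl //.
  by rewrite addnBA // ltnW.
have f_max : f \in sgorder_ge m.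
  apply/sgorder_geP => j jm; have [->|j0] := posnP j.
    rewrite f_coef big1 // => k /andP[_ ki]; apply: coef_gap.
    by rewrite GammaE //; have := ltn_ord i; lia.
  by apply: coef_gap; rewrite GammaE //; lia.
rewrite /Gamma_colon; case: i li {eq_f} f_coef => [[|[|i]] im] /= li f_coef.
- exists (fun=> 0) => //; rewrite big_pred0 //.
  apply: val_inj; apply/polyP => j.
  by rewrite coef0 f_coef big_pred0 // => k; rewrite andbF.
- apply: mem_Gamma_ideal => // [|k]; first by rewrite /=; lia.
  rewrite /= negb_and !negbK => /orP[/eqP->|/eqP->].
    by apply: coef_gap; rewrite GammaE //; lia.
  rewrite f_coef big1 // => k' /andP[_ k'1].
  by apply: coef_gap; rewrite GammaE //; lia.
- exact: mem_Gamma_maximal_ideal.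
Qed.

Lemma Gamma_sub_colon l i i' :
  Gamma_gens l i -> Gamma_gens (Gamma_colon l i) i' ->
  gen_span Gamma_gen (sgorder_ge m) (preceding Gamma_gens l i)
    (Gamma_gen i' * Gamma_gen i).
Proof.
move=> li ci'; have Si' := Gamma_gens_mem ci'; have Si := Gamma_gens_mem li.
have i_gt0 : (0 < i)%N by move: ci'; rewrite /Gamma_colon; case: (i : nat).
have multiple_of k s : (k <= 1)%N -> (k < i)%N -> S s -> (m <= s)%N ->
    (m + i' + (m + i) = s + (m + k))%N ->
    gen_span Gamma_gen (sgorder_ge m) (preceding Gamma_gens l i)
      (Gamma_gen i' * Gamma_gen i).
  move=> k1 ki Ss ms eq_s; have lk := Gamma_gens_le1 li k1.
  have -> : Gamma_gen i' * Gamma_gen i = sgmon K S s * Gamma_gen k.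
    by rewrite -!sgmonD ?eq_s // (Gamma_gens_mem lk).
  by apply: mem_gen_span; [apply/andP | apply: sgmon_order_ge].
have [eq_n|neq_n] := eqVneq (i + i')%N n; last first.
  by apply: (multiple_of ord_m0 (m + i + i')%N) => //=; rewrite ?GammaE //; lia.
have i_gt1 : (1 < i)%N.
  rewrite ltn_neqAle i_gt0 andbT; apply/eqP => i1.
  by move: ci'; rewrite /Gamma_colon -i1 /= => /andP[]; lia.
by apply: (multiple_of ord_m1 (m + n.-1)%N) => //=; rewrite ?GammaE //; lia.
Qed.

Lemma Gamma_koszul_filtration :
  koszul_filtration Gamma_gen Gamma_gens Gamma_colon
    (sgorder_ge m) (sgorder_ge (m + m)).
Proof.
split.
- by move=> l i _; apply/sgmon_order_ge/leq_addr.
- by move=> f g; apply: sgorder_geM.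
- move=> l f fl f2m; have [l0|nl0] := boolP (Gamma_gens l ord_m0).
    exact: Gamma_span_order_ge_2m.
  case: fl => c _ ->; exists (fun=> 0) => [i|]; first exact: rpred0.
  by rewrite !big_pred0 // => i; apply: contraNF nl0 => /Gamma_gens_le1; apply.
- exact: Gamma_colon_sub.
- exact: Gamma_sub_colon.
Qed.

Lemma Gamma_betti_numbers :
  betti_numbers (@sgaug K S)
    (colon_betti Gamma_gens Gamma_colon MaximalIdeal).
Proof.
have order_ge_mE f : (f \in sgorder_ge m) = (sgaug f == 0).
  apply/sgorder_geP/eqP => [f0|f0 j jm]; first by apply: f0; lia.
  by have [->|j0] := posnP j; last by apply: coef_gap; rewrite GammaE //; lia.
apply: (koszul_betti_numbers Gamma_koszul_filtration) => [x|f|f].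
- exact: sgaug_surj.
- by rewrite order_ge_mE => /eqP.
- by move=> /eqP; rewrite -order_ge_mE => /mem_Gamma_maximal_ideal.
Qed.

End GammaKoszul.

Section GammaBetti.
Variables (m n : nat).
Hypotheses (n3 : (3 <= n)%N) (nm : (n < m)%N).
Local Notation betti := (colon_betti (@Gamma_gens m n) (@Gamma_colon m)).

Lemma sum_Gamma_colon (F : Gamma_label -> nat) l :
  (\sum_(i < m) F (Gamma_colon l i) =
   F ZeroIdeal + F PuncturedIdeal + (m - 2) * F MaximalIdeal)%N.
Proof.
have m2 : m = (m - 2).+2 by lia.
rewrite /Gamma_colon m2 !big_ord_recl /= addnA; congr addn.
by rewrite sum_nat_const card_ord !subSS subn0.
Qed.

Lemma betti_ZeroIdealS k : betti ZeroIdeal k.+1 = 0%N.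
Proof. by rewrite /= big_pred0. Qed.

Lemma betti_MaximalIdealS k :
  (betti MaximalIdeal k.+1 + betti MaximalIdeal k =
   betti ZeroIdeal k + betti PuncturedIdeal k +
   (m - 2) * betti MaximalIdeal k)%N.
Proof.
pose i_n : 'I_m := Ordinal nm.
have colon_n : Gamma_colon MaximalIdeal i_n = MaximalIdeal.
  by rewrite /Gamma_colon /=; case: (n) n3 => [|[|]].
rewrite -(sum_Gamma_colon (betti^~ k) MaximalIdeal) [RHS](bigD1 i_n) //=.
by rewrite colon_n addnC.
Qed.

Lemma betti_MaximalIdealS_Punctured k :
  betti MaximalIdeal k.+1 =
  (betti PuncturedIdeal k.+1 + betti MaximalIdeal k)%N.
Proof.
have n1m : (n.-1 < m)%N by lia.
pose i_n1 : 'I_m := Ordinal n1m.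
have colon_n1 : Gamma_colon MaximalIdeal i_n1 = MaximalIdeal.
  by rewrite /Gamma_colon /=; case: (n) n3 => [|[|[|]]].
rewrite /= (bigD1 i_n1) /=; last by lia.
by rewrite colon_n1 addnC.
Qed.

Lemma betti_MaximalIdeal1 : betti MaximalIdeal 1 = (m - 1)%N.
Proof. by have := betti_MaximalIdealS 0; rewrite /=; lia. Qed.

Lemma betti_MaximalIdeal_rec k :
  (betti MaximalIdeal k.+2 + betti MaximalIdeal k =
   (m - 2) * betti MaximalIdeal k.+1)%N.
Proof.
have := betti_MaximalIdealS k.+1; rewrite betti_ZeroIdealS.
by have := betti_MaximalIdealS_Punctured k; lia.
Qed.

End GammaBetti.

Lemma fps_div_linear_rec2 (A : comUnitRingType) (u : fps A) (a b : A) :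
  (forall k, u k.+2 = a * u k.+1 - b * u k) ->
  u =1 fps_div (fps_of_poly ((u 0%N)%:P + (u 1%N - a * u 0%N)%:P * 'X))
               (fps_of_poly (1 - a%:P * 'X + b%:P * 'X^2)).
Proof.
move=> rec_u; set den := 1 - _ + _.
have denE j :
    den`_j = (j == 0%N)%:R - a * (j == 1%N)%:R + b * (j == 2%N)%:R.
  by rewrite coefD coefB coef1 !coefCM coefX coefXn.
apply: fps_div_uniq => [|k]; rewrite /fps_mul /fps_of_poly.
  by rewrite denE !mulr0 subr0 addr0 unitr1.
rewrite coefD coefC coefCM coefX; case: k => [|[|k]] /=.
- by rewrite big_ord1 denE /= !mulr0; ring.
- by rewrite !big_ord_recr big_ord0 /= !denE /=; ring.
rewrite !big_ord_recr /= big1 => [|j _]; last first.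
  by rewrite denE; do 3![case: eqP => [|_]; first by have := ltn_ord j; lia];
    rewrite !mulr0 subr0 addr0 mulr0.
rewrite subnn subSnn; have -> : (k.+2 - k = 2)%N by lia.
by rewrite !denE /= rec_u; ring.
Qed.

Theorem theorem2 (K : fieldType) (m n : nat) (hn : (3 <= n)%N) (hm : (n < m)%N) :
  exists2 beta : nat -> nat,
    betti_numbers (@sgaug K (Gamma m n)) beta &
    (fun i => (beta i)%:Z) =1
      fps_div (fps_of_poly (1 + 'X : {poly int}))
              (fps_of_poly (1 - (m%:Z - 2)%:P * 'X + 'X^2)).
Proof.
pose beta := colon_betti (@Gamma_gens m n) (@Gamma_colon m) MaximalIdeal.
exists beta; first exact: Gamma_betti_numbers.
have beta_rec k :
    (beta k.+2)%:Z = (m%:Z - 2) * (beta k.+1)%:Z - 1 * (beta k)%:Z.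
  by have := betti_MaximalIdeal_rec hn hm k; rewrite -/beta; nia.
have := fps_div_linear_rec2 (u := fun i => (beta i)%:Z) beta_rec.
have -> : (beta 1)%:Z - (m%:Z - 2) * (beta 0)%:Z = 1.
  by rewrite /beta betti_MaximalIdeal1 //=; lia.
by rewrite !mul1r.
Qed.
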